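(* Let $n\ge1$, let $A$ and $\Sigma$ be real symmetric positive definite $n\times n$ matrices, and let $\mu\in\mathbb{R}^n$. Let $P$ be an orthogonal matrix with $P^T\Sigma^{1/2}A\Sigma^{1/2}P=\mathrm{diag}(\lambda_1,\dots,\lambda_n)$ and let $b=(b_1,\dots,b_n)^T=P^T\Sigma^{-1/2}\mu$. Define $$c_0=\exp\Big(-\tfrac12\sum_{i=1}^n b_i^2\Big)\prod_{i=1}^n(2\lambda_i)^{-1/2},\quad d_k=\tfrac12\sum_{i=1}^n(1-kb_i^2)(2\lambda_i)^{-k},\quad c_k=\frac1k\sum_{i=0}^{k-1}d_{k-i}c_i\quad(k\ge1).$$ For $0<\rho<\min_j\lambda_j$ put $$m(\rho)=\prod_{j=1}^n\lambda_j^{-1/2}\,\exp\Big(-\tfrac12\sum_{j=1}^n\frac{b_j^2\lambda_j}{\lambda_j+\rho}\Big)\prod_{j=1}^n\Big(1-\frac{\rho}{\lambda_j}\Big)^{-1/2}.$$ Then for every integer $N\ge0$, every $y>0$ and every $0<\rho<\min_j\lambda_j$, the truncation errors $$e(N)=\sum_{k=N+1}^\infty\left|c_k\frac{y^{\frac n2+k-1}}{\Gamma\left(\frac n2+k\right)}\right|,\qquad E(N)=\sum_{k=N+1}^\infty\left|c_k\frac{y^{\frac n2+k}}{\Gamma\left(\frac n2+k+1\right)}\right|$$ satisfy $$e(N)\le\frac{m(\rho)}{\Gamma\left(\frac n2\right)N!}\left(\frac y2\right)^{\frac n2-1}\left(\frac{y}{2\rho}\right)^{N+1}\exp\left(\frac{y}{2\rho}\right)$$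 and $$E(N)\le\frac{m(\rho)}{\Gamma\left(\frac n2\right)(N+1)!}\left(\frac y2\right)^{\frac n2}\left(\frac{y}{2\rho}\right)^{N+1}\exp\left(\frac{y}{2\rho}\right).$$
   Context: The quantities $e(N)$ and $E(N)$ measure the error made when the series $\sum_{k\ge0}(-1)^kc_k\,y^{n/2+k-1}/\Gamma(n/2+k)$ (density) and $\sum_{k\ge0}(-1)^kc_k\,y^{n/2+k}/\Gamma(n/2+k+1)$ (cumulative distribution function) of the quadratic form $\mathbf{x}^TA\mathbf{x}$, $\mathbf{x}\sim\mathcal{N}(\mu,\Sigma)$, are truncated by dropping all terms with index $k\ge N+1$. $\Sigma^{1/2}$ is the symmetric positive definite square root of $\Sigma$, and $\Gamma$ is the gamma function. *)

(* Defs.v *)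
From HB Require Import structures.
From mathcomp Require Import all_boot all_order all_algebra.
From mathcomp Require Import all_classical all_reals all_analysis.

Set Implicit Arguments.
Unset Strict Implicit.
Unset Printing Implicit Defensive.

Import Order.TTheory GRing.Theory Num.Theory.
Import numFieldNormedType.Exports.

Local Open Scope classical_set_scope.
Local Open Scope ring_scope.

Definition sym_posdef (R : realType) (n : nat) (M : 'M[R]_n) : Prop :=
  M^T = M /\ forall x : 'cV[R]_n, x != 0 -> 0 < (x^T *m M *m x) 0 0.

(* Such an S exists and is unique when M is symmetric positive definite. *)
Definition is_sqrtmx (R : realType) (n : nat) (M S : 'M[R]_n) : Prop :=
  sym_posdef S /\ S *m S = M.

Definition orthogonalmx (R : realType) (n : nat) (P : 'M[R]_n) : Prop :=
  P^T *m P = 1%:M.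

(* Euler's integral; it is finite exactly for s > 0, and Rintegral gives the
   junk value 0 elsewhere. *)
Definition Gamma (R : realType) (s : R) : R :=
  Rintegral (@lebesgue_measure R) `]0, +oo[
    (fun t : R => t `^ (s - 1) * expR (- t)).

(* Minimum of the entries, taken in \bar R so that +oo is the neutral element;
   it is a real number as soon as 0 < n. *)
Definition min_entry (R : realType) (n : nat) (lam : 'rV[R]_n) : \bar R :=
  \big[mine/+oo%E]_(j < n) (lam 0 j)%:E.

Section Coefficients.
Variables (R : realType) (n : nat) (lam : 'rV[R]_n) (b : 'cV[R]_n).

Definition c0_coef : R :=
  expR (- (2^-1 * \sum_(i < n) b i 0 ^+ 2))
  * \prod_(i < n) (2 * lam 0 i) `^ (- 2^-1).

Definition d_coef (k : nat) : R :=
  2^-1 * \sum_(i < n) (1 - k%:R * b i 0 ^+ 2) * (2 * lam 0 i) ^- k.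

(* c_seq k = [:: c_0; ...; c_k] *)
Fixpoint c_seq (k : nat) : seq R :=
  if k is k'.+1 then
    let s := c_seq k' in
    rcons s (k%:R^-1 * \sum_(i < k) d_coef (k - i) * s`_i)
  else [:: c0_coef].

Definition c_coef (k : nat) : R := (c_seq k)`_k.

Lemma size_c_seq k : size (c_seq k) = k.+1.
Proof. by elim: k => //= k IH; rewrite size_rcons IH. Qed.

Lemma nth_c_seq k i : (i <= k)%N -> (c_seq k)`_i = c_coef i.
Proof.
elim: k => [|k IH]; first by case: i.
rewrite leq_eqVlt => /predU1P[-> //|]; rewrite ltnS => ik.
by rewrite /= nth_rcons size_c_seq ltnS ik IH.
Qed.

Lemma c_coef0 : c_coef 0 = c0_coef.
Proof. by []. Qed.

Lemma c_coef_rec k : (0 < k)%N ->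
  c_coef k = k%:R^-1 * \sum_(i < k) d_coef (k - i) * c_coef i.
Proof.
case: k => // k _; rewrite {1}/c_coef /= nth_rcons size_c_seq ltnn eqxx.
by congr (_ * _); apply: eq_bigr => i _; rewrite nth_c_seq // -ltnS.
Qed.

Definition m_bound (rho : R) : R :=
  \prod_(j < n) lam 0 j `^ (- 2^-1)
  * expR (- (2^-1 * \sum_(j < n) b j 0 ^+ 2 * lam 0 j / (lam 0 j + rho)))
  * \prod_(j < n) (1 - rho / lam 0 j) `^ (- 2^-1).

Definition pdf_term (y : R) (k : nat) : R :=
  c_coef k * (y `^ (n%:R / 2 + k%:R - 1) / Gamma (n%:R / 2 + k%:R)).

Definition cdf_term (y : R) (k : nat) : R :=
  c_coef k * (y `^ (n%:R / 2 + k%:R) / Gamma (n%:R / 2 + k%:R + 1)).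

(* The errors live in \bar R, so that a finite bound on them includes the
   convergence of the series. *)
Definition pdf_error (y : R) (N : nat) : \bar R :=
  (\sum_(N.+1 <= k <oo) `|pdf_term y k|%:E)%E.

Definition cdf_error (y : R) (N : nat) : \bar R :=
  (\sum_(N.+1 <= k <oo) `|cdf_term y k|%:E)%E.

End Coefficients.

(* Main.v *)
Require Import Defs.
From HB Require Import structures.
From mathcomp Require Import all_boot all_order all_algebra.
From mathcomp Require Import all_classical all_reals all_analysis.
From mathcomp Require Import measurable_realfun zify ring lra.
Import Order.TTheory GRing.Theory Num.Theory.
Import numFieldNormedType.Exports.
Local Open Scope classical_set_scope.
Local Open Scope ring_scope.

(** The generating function of the c_k is
      C(z) = c_0 prod_i (1 - x_i)^(-1/2) exp (- 1/2 sum_i b_i^2 x_i / (1 - x_i)),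
    with x_i = z / (2 lam_i), and its modulus on |z| = 2 rho is at most
    2^(-n/2) m(rho), which suggests |c_k| <= 2^(-n/2) m(rho) (2 rho)^(-k) by
    Cauchy's inequality.  Here this bound is obtained without complex analysis:
    replacing b_i^2 by t b_i^2, the scaled coefficients become polynomials in t
    whose l^2-norm satisfies a linear differential inequality, and at t = 0 they
    are nonnegative with sum at most prod_i (1 - rho / lam_i)^(-1/2).

    Since Gamma (n/2 + k) = Gamma (n/2) prod_(j < k) (n/2 + j), each term is then
    compared with a term of an exponential series.  For the density the product
    is at least (k - 1)!/2, which suffices.  For the distribution function one
    needs prod_(j <= k) (n/2 + j) >= k!, which fails exactly when n = 1 and
    k = 1, 2; the slack in Cauchy's inequality makes up for it there. *)

(** * Exponentials of power series *)

(** The values are accumulated in a list, one per step. By the locality hypothesis [G k] looks only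
    at entries already in the list, so the default [x0] never matters. *)
Lemma course_of_values_rec (T : Type) (x0 : T) (G : nat -> (nat -> T) -> T) :
  (forall k f g, (forall i, (i < k)%N -> f i = g i) -> G k f = G k g) ->
  exists a : nat -> T, forall k, a k = G k a.
Proof.
move=> Gext.
pose s k := iteri k (fun j t => rcons t (G j (nth x0 t))) [::].
have size_s k : size (s k) = k by elim: k => //= k IH; rewrite size_rcons IH.
have nth_s k i : (i < k)%N -> nth x0 (s k) i = nth x0 (s i.+1) i.
  elim: k => // k IH; rewrite ltnS leq_eqVlt => /predU1P[-> //|ik].
  by rewrite -IH //= nth_rcons size_s ik.
exists (fun k => nth x0 (s k.+1) k) => k /=.
rewrite nth_rcons size_s ltnn eqxx.
by apply: Gext => i ik; rewrite nth_s.
Qed.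

Lemma sum_triangle (V : nmodType) (F : nat -> nat -> V) (k : nat) :
  \sum_(i < k) \sum_(j < i) F i j = \sum_(j < k) \sum_(j.+1 <= i < k) F i j.
Proof.
elim: k => [|k IH]; first by rewrite !big_ord0.
rewrite big_ord_recr /= IH [RHS]big_ord_recr /= [X in _ = _ + X]big_geq // addr0.
rewrite -big_split /=; apply: eq_bigr => j _.
by rewrite big_nat_recr //=.
Qed.

(** Both sides are the coefficient of index $k$ in the product of three series, where those of [f]
    and [g] have no constant term. The substitution $i \mapsto j + k - i$ in the inner sum exchanges
    the roles of [f] and [g]. *)
Lemma convolution_left_comm (A : comNzRingType) (f g h : nat -> A) (k : nat) :
  \sum_(i < k) f (k - i)%N * (\sum_(j < i) g (i - j)%N * h j) =
  \sum_(i < k) g (k - i)%N * (\sum_(j < i) f (i - j)%N * h j).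
Proof.
have E (f' g' : nat -> A) :
    \sum_(i < k) f' (k - i)%N * (\sum_(j < i) g' (i - j)%N * h j) =
    \sum_(j < k) (\sum_(j.+1 <= i < k) f' (k - i)%N * g' (i - j)%N) * h j.
  under eq_bigr do rewrite mulr_sumr.
  rewrite (sum_triangle _ (fun i j => f' (k - i)%N * (g' (i - j)%N * h j))).
  apply: eq_bigr => j _; rewrite mulr_suml.
  by apply: eq_bigr => i _; rewrite mulrA.
rewrite !E; apply: eq_bigr => j _; congr (_ * _).
rewrite big_nat_rev /=; apply: eq_big_nat => i /andP[ji ik].
rewrite mulrC; by congr (g _ * f _); lia.
Qed.

(* The generating function of [a] is a_0 exp (sum_(k >= 1) d_k w^k / k). *)
Definition exp_recursion {A : nzRingType} (d a : nat -> A) : Prop :=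
  forall k, k%:R * a k = \sum_(j < k) d (k - j)%N * a j.

Section ExpRecursion.
Context {R : numFieldType}.
Implicit Types (d phi : nat -> {poly R}).

Lemma exp_recursion_poly d :
  exists a : nat -> {poly R}, a 0%N = 1 /\ exp_recursion d a.
Proof.
pose G k (f : nat -> {poly R}) : {poly R} :=
  if k is 0 then 1 else k%:R^-1%:P * \sum_(j < k) d (k - j)%N * f j.
have [|a aE] := @course_of_values_rec {poly R} 0 G.
  move=> [//|k] f g fg; congr (_ * _); apply: eq_bigr => j _.
  by rewrite fg.
exists a; split=> [|k]; first by rewrite aE.
case: k => [|k]; first by rewrite mul0r big_ord0.
by rewrite {1}aE /G mulrA -polyC_natr -polyCM divff ?mul1r //.
Qed.

(** The recursion is linear in [a], so this is its uniqueness principle. An integral domain is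
    general enough to cover both scalars and polynomials in the parameter. *)
Lemma exp_recursion0 (A : idomainType) (d a : nat -> A) :
  (forall k, (0 < k)%N -> k%:R != 0 :> A) -> a 0%N = 0 -> exp_recursion d a ->
  forall k, a k = 0.
Proof.
move=> nz a0 arec; elim/ltn_ind => -[//|k] IH.
have := arec k.+1; rewrite big1; last by move=> j _; rewrite IH ?mulr0.
by move/eqP; rewrite mulf_eq0 (negPf (nz _ _)) //= => /eqP.
Qed.

Lemma exp_recursion_inj (d a a' : nat -> R) :
  a 0%N = a' 0%N -> exp_recursion d a -> exp_recursion d a' -> a =1 a'.
Proof.
move=> e0 ha ha' k; apply/eqP; rewrite -subr_eq0; apply/eqP.
apply: (@exp_recursion0 R d (fun k => a k - a' k)) => [j|| j].
- by rewrite pnatr_eq0; case: j.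
- by rewrite e0 subrr.
- rewrite mulrBr ha ha' -sumrB.
  by apply: eq_bigr => i _; rewrite mulrBr.
Qed.

(* If d_k' = - k phi_k then differentiating exp (sum_k d_k w^k / k) with
   respect to the parameter multiplies it by - sum_k phi_k w^k. *)
Lemma deriv_exp_recursion d phi a :
  (forall k, (d k)^`() = - (k%:R * phi k)) ->
  a 0%N = 1 -> exp_recursion d a ->
  forall k, (a k)^`() = - \sum_(j < k) phi (k - j)%N * a j.
Proof.
move=> dE a0 arec k; apply/eqP; rewrite -addr_eq0; apply/eqP.
(* The defect $a_k' + \sum_j \varphi_{k-j} a_j$ vanishes at $k = 0$ and obeys the same recursion as
   [a], hence is zero. *)
move: k; apply: (@exp_recursion0 _ d) => [k k0||k].
- by rewrite -polyC_natr polyC_eq0 pnatr_eq0 -lt0n.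
- by rewrite a0 big_ord0 addr0 -polyC1 derivC.
rewrite mulrDr.
have -> : k%:R * (a k)^`() = (k%:R * a k)^`().
  by rewrite derivM -polyC_natr derivC mul0r add0r.
rewrite arec linear_sum /=.
have -> : \sum_(j < k) (d (k - j)%N * a j)^`() =
    \sum_(j < k) - ((k - j)%:R * phi (k - j)%N * a j)
    + \sum_(j < k) d (k - j)%N * (a j)^`().
  by rewrite -big_split; apply: eq_bigr => j _; rewrite derivM dE mulNr.
have -> : k%:R * (\sum_(j < k) phi (k - j)%N * a j) =
    \sum_(j < k) (k - j)%:R * phi (k - j)%N * a j
    + \sum_(j < k) phi (k - j)%N * (j%:R * a j).
  rewrite mulr_sumr -big_split; apply: eq_bigr => j _ /=.
  by rewrite natrB ?(ltnW (ltn_ord _)) //; ring.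
have -> : \sum_(j < k) phi (k - j)%N * (j%:R * a j) =
    \sum_(j < k) d (k - j)%N * (\sum_(i < j) phi (j - i)%N * a i).
  under eq_bigr do rewrite arec.
  exact: convolution_left_comm.
rewrite sumrN.
under [RHS]eq_bigr do rewrite mulrDr.
rewrite big_split /=; ring.
Qed.

End ExpRecursion.

(** The function $p(t) e^{-g(t)}$ has nonpositive derivative on $(0, 1)$, so the mean value theorem
    compares its values at the endpoints. *)
Lemma gronwall_poly {R : realType} (p : {poly R}) (g dg : R -> R) :
  (forall t : R, 0 <= t <= 1 -> is_derive t 1 g (dg t)) ->
  (forall t : R, 0 < t < 1 -> p^`().[t] <= dg t * p.[t]) ->
  p.[1] <= p.[0] * expR (g 1 - g 0).
Proof.
move=> gder ple.
pose h t := p.[t] * expR (- g t).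
pose dh t := (p^`().[t] - dg t * p.[t]) * expR (- g t).
have hder (t : R) : 0 <= t <= 1 -> is_derive t 1 h (dh t).
  move=> /gder dgt.
  have dpt : is_derive t 1 (horner p) p^`().[t] by exact: is_derive_poly.
  have dN : is_derive t 1 (- g) (- dg t) by exact: is_deriveN.
  have dE := @is_derive1_comp _ expR (- g) t _ _ (is_derive_expR (- g t)) dN.
  apply: (@is_derive_eq _ _ _ h t 1 _ _ (is_deriveM dpt dE)).
  by rewrite /dh /GRing.scale /=; ring.
have [c c01 hE] : exists2 c, c \in `]0, 1[ & h 1 - h 0 = dh c * (1 - 0).
  apply: MVT => // [x|].
    by rewrite in_itv /= => /andP[x0 x1]; apply: hder; rewrite !ltW.
  apply: derivable_within_continuous => x; rewrite in_itv /= => x01.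
  by case: (hder x x01).
have : h 1 <= h 0.
  rewrite -subr_le0 hE subr0 mulr1 mulr_le0_ge0 ?expR_ge0 //.
  by rewrite subr_le0 ple //; move: c01; rewrite in_itv.
rewrite /h => /(ler_wpM2r (expR_ge0 (g 1))).
by rewrite -!mulrA -!expRD addNr expR0 mulr1 [- g 0 + _]addrC.
Qed.

(* Toeplitz counterpart of Re (- r w / (1 - r w)) <= r / (1 + r) for |w| <= 1: with
   u_k = sum_(j <= k) r^(k - j) v_j and w = u_(k - 1), the inequality telescopes by
   v_k^2 + (1 + r) w v_k = (1 - r)/2 (u_k + w)^2 + (1 + r)/2 (u_k^2 - w^2). *)
Lemma geometric_toeplitz_bound {R : realFieldType} (r : R) (v : nat -> R)
    (K : nat) : 0 <= r <= 1 ->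
  - \sum_(k < K) v k * (\sum_(j < k) r ^+ (k - j) * v j) <=
  r / (1 + r) * \sum_(k < K) v k ^+ 2.
Proof.
move=> /andP[r0 r1].
pose U k := \sum_(j < k) r ^+ (k - j.+1) * v j.
have US k : U k.+1 = r * U k + v k.
  rewrite /U big_ord_recr /= subnn expr0 mul1r mulr_sumr; congr (_ + _).
  apply: eq_bigr => j _; rewrite mulrA -exprS; congr (r ^+ _ * _).
  by have := ltn_ord j; lia.
have rU k : \sum_(j < k) r ^+ (k - j) * v j = r * U k.
  rewrite /U mulr_sumr; apply: eq_bigr => j _.
  by rewrite mulrA -exprS -subSn.
(* The boundary term left by telescoping is kept to make the induction work; being nonnegative, it
   is dropped at the end. *)
have pos : r * (1 + r) / 2 * U K ^+ 2 <=
    r * (\sum_(k < K) v k ^+ 2) + (1 + r) * \sum_(k < K) v k * (r * U k).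
  elim: K => [|K IH]; first by rewrite /U !big_ord0; lra.
  rewrite US !big_ord_recr /=.
  suff : r * (1 + r) / 2 * ((r * U K + v K) ^+ 2 - U K ^+ 2) <=
    r * v K ^+ 2 + (1 + r) * (v K * (r * U K)) by move: IH; lra.
  rewrite -subr_ge0.
  have -> : r * v K ^+ 2 + (1 + r) * (v K * (r * U K)) -
     r * (1 + r) / 2 * ((r * U K + v K) ^+ 2 - U K ^+ 2) =
     r * (1 - r) / 2 * ((1 + r) * U K + v K) ^+ 2 by field.
  by rewrite mulr_ge0 ?sqr_ge0 // !mulr_ge0 // subr_ge0.
under eq_bigr do rewrite rU.
have r1_gt0 : 0 < 1 + r by lra.
rewrite mulrAC ler_pdivlMr //.
have : 0 <= r * (1 + r) / 2 * U K ^+ 2.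
  by rewrite mulr_ge0 ?sqr_ge0 // !mulr_ge0 // addr_ge0.
move: pos; lra.
Qed.

Lemma geometric_tail_le {R : realFieldType} (x : R) (m k : nat) :
  0 <= x < 1 -> \sum_(m.+1 <= i < k) x ^+ (i - m) <= x / (1 - x).
Proof.
move=> /andP[x0 x1]; rewrite -{1}(add0n m.+1) big_addn big_mkord.
have -> : \sum_(i < k - m.+1) x ^+ (i + m.+1 - m) =
    x * \sum_(i < k - m.+1) x ^+ i.
  rewrite mulr_sumr; apply: eq_bigr => i _.
  by rewrite addnS -addSn addnK exprS.
rewrite ler_wpM2l // -[leRHS]div1r ler_pdivlMr ?subr_gt0 //.
have := subrX1 x (k - m.+1); have := exprn_ge0 (k - m.+1) x0; lra.
Qed.

(** The generating function is $\prod_i (1 - r_i w)^{-1/2}$. Its coefficients are nonnegative, so a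
    truncation at $w = 1$ should not exceed the full value; Gronwall's inequality in $w$ proves this
    without summing the series. *)
Lemma positive_exp_recursion_bound {R : realType} {n : nat} (r : 'I_n -> R)
    (a : nat -> R) :
  (forall i, 0 <= r i < 1) -> a 0%N = 1 ->
  exp_recursion (fun k => 2^-1 * \sum_i r i ^+ k) a ->
  (forall k, 0 <= a k) /\
  forall K, \sum_(k < K) a k <= \prod_i (1 - r i) `^ (- 2^-1).
Proof.
move=> r01 a0 arec.
have a_ge0 k : 0 <= a k.
  elim/ltn_ind: k => -[|k] IH; first by rewrite a0.
  have : 0 <= k.+1%:R * a k.+1.
    rewrite arec sumr_ge0 // => j _; rewrite mulr_ge0 ?IH // mulr_ge0 //.
    by rewrite sumr_ge0 // => i _; rewrite exprn_ge0 //; case/andP: (r01 i).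
  by rewrite pmulr_rge0 ?ltr0n.
split=> // K.
pose p := \sum_(k < K) (a k)%:P * 'X^k.
(* [g] is the logarithm of the expected generating function and [dg] its derivative. *)
pose g (t : R) := - (2^-1 * \sum_i ln (1 - t * r i)).
pose dg (t : R) := 2^-1 * \sum_i r i / (1 - t * r i).
have tr_lt1 (t : R) i : 0 <= t <= 1 -> 0 <= t * r i < 1.
  move=> /andP[t0 t1]; have /andP[ri0 ri1] := r01 i.
  rewrite mulr_ge0 //=; apply: le_lt_trans ri1.
  by rewrite ler_piMl.
have dgE (t : R) : 0 <= t <= 1 -> is_derive t 1 g (dg t).
  move=> t01.
  have dln i : is_derive t 1 (fun x => ln (1 - x * r i)) (- r i / (1 - t * r i)).
    have pos : 0 < 1 - t * r i by have := tr_lt1 t i t01; lra.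
    have din : is_derive t 1 (fun x : R => 1 - x * r i) (- r i).
      have -> : (fun x : R => 1 - x * r i) = horner (1 - 'X * (r i)%:P).
        by apply/funext => x; rewrite !hornerE.
      apply: is_derive_eq.
      by rewrite derivB derivM derivX -polyC1 !derivC !hornerE; ring.
    have := @is_derive1_comp _ (@ln R) (fun x => 1 - x * r i) t _ _
      (is_derive1_ln pos) din.
    by rewrite mulrC.
  have dsum := @is_derive_sum _ _ _ _ (fun i (x : R) => ln (1 - x * r i)) t 1 _ dln.
  have dZ := @is_deriveZ _ _ _ _ (- 2^-1) t 1 _ dsum.
  have -> : g = (- 2^-1) \*: \sum_i (fun x : R => ln (1 - x * r i)).
    by apply/funext => x; rewrite /g /= fct_sumE /GRing.scale /= mulNr.
  apply: (is_derive_eq dZ).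
  rewrite /dg /GRing.scale /= mulNr -mulrN -sumrN; congr (_ * _).
  by apply: eq_bigr => i _; rewrite mulNr opprK.
have ph (t : R) : p.[t] = \sum_(k < K) a k * t ^+ k.
  by rewrite horner_sum; apply: eq_bigr => k _; rewrite !hornerE.
have p1 : p.[1] = \sum_(k < K) a k.
  by rewrite ph; apply: eq_bigr => k _; rewrite expr1n mulr1.
have p0 : p.[0] <= 1.
  rewrite ph; case: (K) => [|K']; first by rewrite big_ord0.
  rewrite big_ord_recl a0 expr0 mulr1 big1 ?addr0 // => i _.
  by rewrite expr0n mulr0.
(* After multiplication by [t], the recursion turns $t p'(t)$ into a double sum. Grouped by [j], its
   inner sums are truncated geometric tails in $t r_i$, at most $t r_i / (1 - t r_i)$. *)
have ple (t : R) : 0 < t < 1 -> p^`().[t] <= dg t * p.[t].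
  move=> /andP[t0 t1].
  have t01 : 0 <= t <= 1 by rewrite !ltW.
  rewrite -(ler_pM2l t0).
  have -> : t * p^`().[t] = \sum_(k < K) (k%:R * a k) * t ^+ k.
    rewrite linear_sum horner_sum mulr_sumr; apply: eq_bigr => k _ /=.
    rewrite derivM derivC derivXn mul0r add0r hornerM hornerC hornerMn hornerXn.
    case: (nat_of_ord k) => [|m]; first by rewrite mulr0n; ring.
    by rewrite /= -mulr_natl exprS; ring.
  have -> : \sum_(k < K) (k%:R * a k) * t ^+ k =
    \sum_(j < K) (\sum_(j.+1 <= k < K)
       (2^-1 * \sum_i (t * r i) ^+ (k - j))) * (a j * t ^+ j).
    under eq_bigr do rewrite arec mulr_suml.
    rewrite (sum_triangle _ (fun k j =>
       2^-1 * (\sum_i r i ^+ (k - j)) * a j * t ^+ k)).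
    apply: eq_bigr => j _; rewrite mulr_suml; apply: eq_big_nat => k /andP[jk _].
    under [in RHS]eq_bigr do rewrite exprMn.
    have -> : t ^+ k = t ^+ (k - j) * t ^+ j by rewrite -exprD subnK // ltnW.
    by rewrite -mulr_sumr; ring.
  rewrite ph mulrA mulr_sumr; apply: ler_sum => j _.
  rewrite ler_wpM2r ?(mulr_ge0 (a_ge0 _)) ?(exprn_ge0 _ (ltW t0)) //.
  rewrite -mulr_sumr exchange_big /= /dg mulrCA ler_wpM2l // mulr_sumr.
  apply: ler_sum => i _.
  by rewrite mulrA geometric_tail_le ?tr_lt1.
rewrite -p1; apply: le_trans (gronwall_poly p g dg dgE ple) _.
have -> : g 0 = 0.
  by rewrite /g big1 ?mulr0 ?oppr0 // => i _; rewrite mul0r subr0 ln1.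
rewrite subr0; apply: le_trans (ler_wpM2r (expR_ge0 _) p0) _.
rewrite mul1r /g -mulNr mulr_sumr expR_sum; apply: ler_prod => i _.
rewrite expR_ge0 /= /powR mul1r ifF //.
by apply/negbTE; have := r01 i; lra.
Qed.

(** With [t] multiplying every [s i], the sum [V] of the squares of the first $K + 1$ coefficients
    satisfies $V' \le c V$, by the Toeplitz bound applied to each [r i]. Then $|a_K|^2 \le V(1) \le
    e^c V(0)$, and taking square roots halves the exponent. *)
Lemma exp_recursion_bound {R : realType} {n : nat} (r s : 'I_n -> R)
    (a : nat -> R) :
  (forall i, 0 <= r i < 1) -> (forall i, 0 <= s i) -> a 0%N = 1 ->
  exp_recursion (fun k => 2^-1 * \sum_i (1 - k%:R * s i) * r i ^+ k) a ->
  forall k, `|a k| <= \prod_i (1 - r i) `^ (- 2^-1) *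
    expR (2^-1 * \sum_i s i * r i / (1 + r i)).
Proof.
move=> r01 s_ge0 a0 arec K.
pose alpha k := 2^-1 * \sum_i r i ^+ k.
pose phi k := 2^-1 * \sum_i s i * r i ^+ k.
(* At $t = 1$ this is the given sequence; at $t = 0$ only the nonnegative part without [s]
   remains. *)
pose d k : {poly R} := (alpha k)%:P - (k%:R * phi k)%:P * 'X.
have [A [A0 Arec]] := exp_recursion_poly d.
have Ader k : (A k)^`() = - \sum_(j < k) (phi (k - j)%N)%:P * A j.
  apply: (deriv_exp_recursion d (fun k => (phi k)%:P)) => // j.
  rewrite /d derivB derivM derivX !derivC mul0r !add0r mulr1.
  by rewrite polyCM polyC_natr.
have Aeval (t : R) : exp_recursion (fun k => (d k).[t]) (fun k => (A k).[t]).
  move=> k; have := congr1 (horner^~ t) (Arec k).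
  rewrite -polyC_natr hornerM hornerC => ->.
  by rewrite horner_sum; apply: eq_bigr => j _; rewrite hornerM.
have dE (t : R) k : (d k).[t] = alpha k - k%:R * phi k * t.
  by rewrite /d !hornerE.
have A1 k : (A k).[1] = a k.
  move: k; apply: (exp_recursion_inj (fun k => (d k).[1])) => //.
    by rewrite A0 hornerC a0.
  move=> k; rewrite arec; apply: eq_bigr => j _; congr (_ * _).
  rewrite dE mulr1 /alpha /phi mulrCA -mulrBr; congr (_ * _).
  rewrite mulr_sumr -sumrB.
  by apply: eq_bigr => i _; ring.
have [A_ge0 sumA] : (forall k, 0 <= (A k).[0]) /\
    forall K, \sum_(k < K) (A k).[0] <= \prod_i (1 - r i) `^ (- 2^-1).
  apply: positive_exp_recursion_bound => //; first by rewrite A0 hornerC.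
  move=> k; rewrite Aeval; apply: eq_bigr => j _.
  by rewrite dE mulr0 subr0.
pose V := \sum_(k < K.+1) A k ^+ 2.
pose c := \sum_i s i * r i / (1 + r i).
have VE (t : R) : V.[t] = \sum_(k < K.+1) (A k).[t] ^+ 2.
  by rewrite horner_sum; apply: eq_bigr => k _; rewrite horner_exp.
have V1 : V.[1] <= V.[0] * expR (c * 1 - c * 0).
  apply: (gronwall_poly V (fun t => c * t) (fun=> c)) => t _.
    have -> : (fun x => c * x) = horner (c%:P * 'X).
      by apply/funext => x; rewrite !hornerE.
    apply: is_derive_eq.
    by rewrite derivM derivC derivX mul0r add0r mulr1 hornerC.
  have -> : V^`().[t] = \sum_i s i * - \sum_(k < K.+1) (A k).[t] *
      (\sum_(j < k) r i ^+ (k - j) * (A j).[t]).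
    have -> : V^`().[t] = \sum_(k < K.+1) - (2 * (A k).[t] *
        \sum_(j < k) phi (k - j)%N * (A j).[t]).
      rewrite linear_sum horner_sum; apply: eq_bigr => k _ /=.
      rewrite expr2 derivM Ader hornerD !hornerM hornerN horner_sum.
      rewrite (eq_bigr (fun j : 'I_k => phi (k - j)%N * (A j).[t])) => [|j _].
        by ring.
      by rewrite hornerM hornerC.
    under [RHS]eq_bigr do rewrite mulrN mulr_sumr -sumrN.
    rewrite exchange_big /=; apply: eq_bigr => k _.
    rewrite sumrN; congr (- _).
    under [RHS]eq_bigr do rewrite mulrCA mulr_sumr.
    rewrite -mulr_sumr exchange_big /= [2 * _]mulrC -mulrA; congr (_ * _).
    rewrite mulr_sumr; apply: eq_bigr => j _.
    rewrite /phi !mulrA divff ?pnatr_eq0 // mul1r mulr_suml.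
    by apply: eq_bigr => i _; rewrite mulrA.
  rewrite /c mulr_suml; apply: ler_sum => i _.
  rewrite -!mulrA ler_wpM2l // mulrA VE.
  apply: (geometric_toeplitz_bound (r i) (fun k => (A k).[t])).
  by have := r01 i; lra.
have V0 : V.[0] <= (\prod_i (1 - r i) `^ (- 2^-1)) ^+ 2.
  (* For nonnegative numbers the sum of squares is at most the square of the sum. *)
  apply: (@le_trans _ _ ((\sum_(k < K.+1) (A k).[0]) ^+ 2)).
    rewrite VE; elim: (K.+1) => [|m IH]; first by rewrite !big_ord0 expr0n.
    rewrite !big_ord_recr /= sqrrD -addrA lerD // lerDr mulrn_wge0 //.
    by rewrite mulr_ge0 ?sumr_ge0.
  by rewrite ler_pXn2r ?nnegrE ?sumr_ge0 ?prodr_ge0 // => i _; exact: powR_ge0.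
have Pge0 : 0 <= \prod_i (1 - r i) `^ (- 2^-1).
  by rewrite prodr_ge0 // => i _; exact: powR_ge0.
rewrite -(@ler_pXn2r _ 2) ?nnegrE ?mulr_ge0 ?expR_ge0 //.
rewrite real_normK ?num_real // exprMn.
apply: (@le_trans _ _ V.[1]).
  rewrite VE big_ord_recr /= A1 lerDr sumr_ge0 // => k _.
  exact: sqr_ge0.
apply: le_trans V1 _; rewrite mulr1 mulr0 subr0.
have -> : expR c = expR (2^-1 * c) ^+ 2.
  by rewrite expr2 -expRD -mulrDl; congr expR; field.
by rewrite ler_wpM2r ?exprn_ge0 ?expR_ge0.
Qed.

(** * The gamma function *)

Section GammaIntegral.
Context {R : realType}.
Local Notation mu := (@lebesgue_measure R).
Local Notation integrand s := (fun t : R => (t `^ (s - 1) * expR (- t))%:E).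
Implicit Types s a b t : R.

(** The integral is kept in the extended reals so that the functional equation can be proved before
    finiteness, and then used to prove it. *)
Definition Gamma_integral s : \bar R := (\int[mu]_(t in `]0%R, +oo[) integrand s t)%E.

Lemma Gamma_integrand_ge0 s t : (0 <= integrand s t)%E.
Proof. by rewrite lee_fin mulr_ge0 ?powR_ge0 ?expR_ge0. Qed.

Lemma measurable_Gamma_integrand s (D : set R) : measurable_fun D (integrand s).
Proof.
apply: measurable_funTS; apply/measurable_EFinP.
apply: measurable_funM; first exact: measurable_powR.
by apply: measurableT_comp.
Qed.

Lemma Gamma_integral_ge0 s : (0 <= Gamma_integral s)%E.
Proof. by apply: integral_ge0 => t _; exact: Gamma_integrand_ge0. Qed.

Lemma derivable_oo_LRcontinuousS (f : R -> R) a b : a <= b ->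
  (forall x, a <= x <= b -> derivable f x 1) -> derivable_oo_LRcontinuous f a b.
Proof.
move=> ab df.
have cf x : a <= x <= b -> f z @[z --> x] --> f x.
  by move=> /df /derivable1_diffP /differentiable_continuous.
split=> [x|//|//].
- by rewrite in_itv /= => /andP[ax xb]; apply: df; rewrite !ltW.
- by apply: cvg_at_right_filter; apply: cf; rewrite lexx.
- by apply: cvg_at_left_filter; apply: cf; rewrite lexx ab.
Qed.

(** The antiderivative of $e^{-t}$ is taken as $-e^{-t}$. The segment stays away from $0$, where
    $t^{s-1}$ is unbounded if $s < 1$. *)
Lemma Gamma_integrand_by_parts s a b : 0 < s -> 0 < a < b ->
  (\int[mu]_(t in `[a, b]) integrand (s + 1) t =
   (a `^ s * expR (- a) - b `^ s * expR (- b))%:E +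
   s%:E * \int[mu]_(t in `[a, b]) integrand s t)%E.
Proof.
move=> s0 /andP[a0 ab].
have dpow (u x : R) : a <= x <= b -> is_derive x 1 (@powR R ^~ u) (u * x `^ (u - 1)).
  by move=> /andP[ax _]; apply: is_derive1_powR; exact: lt_le_trans ax.
have dexp (x : R) : is_derive x 1 (fun t : R => - expR (- t)) (expR (- x)).
  have dN : is_derive x 1 (fun t : R => - t) (- 1) by exact: is_deriveNid.
  have dc := @is_derive1_comp _ (@expR R) (fun t => - t) x _ _ (is_derive_expR (- x)) dN.
  by apply: (is_derive_eq (is_deriveN dc)); rewrite mulrN1 opprK.
have -> : (\int[mu]_(t in `[a, b]) integrand (s + 1) t =
    \int[mu]_(t in `[a, b]) (t `^ s * expR (- t))%:E)%E.
  by apply: eq_integral => t _; rewrite addrK.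
rewrite (@integration_by_parts _ (@powR R ^~ s) (fun t => - expR (- t))
  (fun t => s * t `^ (s - 1)) (fun t => expR (- t))) //.
- rewrite -ge0_integralZl_EFin //; last 3 first.
  + by move=> t _; exact: Gamma_integrand_ge0.
  + exact: measurable_Gamma_integrand.
  + exact: ltW.
  have -> : (\int[mu]_(t in `[a, b]) (s * t `^ (s - 1) * - expR (- t))%:E =
      - \int[mu]_(t in `[a, b]) (s%:E * integrand s t))%E.
    rewrite -integral_ge0N => [|t _]; last first.
      by rewrite mule_ge0 ?Gamma_integrand_ge0 // lee_fin ltW.
    by apply: eq_integral => t _; rewrite -EFinM -EFinN mulrN mulrA.
  rewrite oppeK; congr (_%:E + _)%E.
  ring.
- apply: derivable_within_continuous => x; rewrite in_itv /= => xab.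
  by apply: derivableM => //; case: (dpow (s - 1) x xab).
- apply: derivable_oo_LRcontinuousS; first exact: ltW.
  by move=> x xab; case: (dpow s x xab).
- move=> x; rewrite in_itv /= => /andP[ax xb].
  have xab : a <= x <= b by rewrite !ltW.
  by rewrite derive1E; have [_ ->] := dpow s x xab.
- apply: continuous_subspaceT => x; apply: continuous_comp.
    exact: opp_continuous.
  exact: continuous_expR.
- apply: derivable_oo_LRcontinuousS; first exact: ltW.
  by move=> x _; case: (dexp x).
- by move=> x _; rewrite derive1E; have [_ ->] := dexp x.
Qed.


(** The exponential dominates $b^{m+1}/(m+1)!$, one power more than $b^s$ requires; the spare power
    gives the decay. *)
Lemma powR_expRN_le s b (m : nat) : 1 <= b -> s <= m%:R ->
  b `^ s * expR (- b) <= m.+1`!%:R * b^-1.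
Proof.
move=> b1 sm; have b0 : 0 < b by exact: lt_le_trans b1.
have bs : b `^ s <= b ^+ m by rewrite -powR_mulrn ?(ltW b0) //; exact: ler_powR.
have be : b ^+ m.+1 / m.+1`!%:R <= expR b.
  by apply: le_trans (expR_ge1Dxn m (ltW b0)); rewrite lerDr.
rewrite expRN ler_pdivrMr ?expR_gt0 //; apply: le_trans bs _.
have fact_neq0 : m.+1`!%:R != 0 :> R by rewrite pnatr_eq0 -lt0n fact_gt0.
apply: le_trans (ler_wpM2l _ be).
  by rewrite exprS le_eqVlt; apply/orP; left; apply/eqP; field; rewrite fact_neq0 gt_eqF.
by rewrite mulr_ge0 ?invr_ge0 ?ltW.
Qed.

Lemma cvg_Gamma_boundary s : 0 < s ->
  (k.+2%:R^-1 `^ s * expR (- k.+2%:R^-1) - k.+2%:R `^ s * expR (- k.+2%:R) : R)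
    @[k --> \oo] --> (0 : R).
Proof.
move=> s0.
have inv0 : (k.+2%:R^-1 : R) @[k --> \oo] --> (0 : R).
  by have := @cvg_harmonic R; rewrite -(cvg_shiftS (@harmonic R)); exact.
have pow0 : (k.+2%:R^-1 `^ s : R) @[k --> \oo] --> (0 : R).
  have /cvg_at_rightP := @powR_cvg0 R s s0.
  by apply; split => // k; rewrite invr_gt0.
rewrite -[X in _ --> X](subr0 0); apply: cvgB.
  apply: (@squeeze_cvgr _ _ _ _ (fun=> 0) (fun k => k.+2%:R^-1 `^ s)) pow0.
  - apply: nearW => k; rewrite mulr_ge0 ?powR_ge0 ?expR_ge0 //=.
    by rewrite ler_piMr ?powR_ge0 // expR_le1 oppr_le0 invr_ge0.
  - exact: cvg_cst.
have [m sm] : exists m : nat, s <= m%:R.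
  by exists (Num.truncn s).+1; rewrite ltW // truncnS_gt.
have Cinv : (m.+1`!%:R * k.+2%:R^-1 : R) @[k --> \oo] --> (0 : R).
  by rewrite -(mulr0 m.+1`!%:R); apply: cvgMr.
apply: (@squeeze_cvgr _ _ _ _ (fun=> 0) (fun k => m.+1`!%:R * k.+2%:R^-1)) Cinv.
- apply: nearW => k; rewrite mulr_ge0 ?powR_ge0 ?expR_ge0 //=.
  by rewrite powR_expRN_le // ler1n.
- exact: cvg_cst.
Qed.

(** The shift by 2 makes the left end strictly smaller than the right end already for $k = 0$. *)
Let segment (k : nat) : set R := `[k.+2%:R^-1, k.+2%:R].

Lemma cvg_Gamma_integral s :
  (\int[mu]_(t in segment k) integrand s t)%E @[k --> \oo] -->
  Gamma_integral s.
Proof.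
have -> : Gamma_integral s =
    (\int[mu]_(t in \bigcup_k segment k) integrand s t)%E.
  congr integral; apply/seteqP; split => t /=.
    rewrite in_itv /= andbT => t0.
    exists (maxn (Num.truncn t) (Num.truncn t^-1)) => //=.
    rewrite /segment /= in_itv /= -[X in _ <= X <= _]invrK.
    rewrite lef_pV2 ?posrE ?invr_gt0 // invrK.
    have le_max (x : R) m : (Num.truncn x <= m)%N -> x <= m.+2%:R.
      move=> xm; apply: ltW; apply: lt_le_trans (truncnS_gt x) _.
      by rewrite ler_nat ltnS; apply: leq_trans xm _.
    by rewrite !le_max ?leq_maxl ?leq_maxr.
  move=> [k _]; rewrite /segment /= !in_itv /= andbT => /andP[+ _].
  by apply: lt_le_trans; rewrite invr_gt0.
apply: ge0_nondecreasing_set_cvg_integral => [|k|k|k t _].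
- apply/nondecreasing_seqP => k; apply/subsetPset => t; rewrite /segment /=.
  rewrite !in_itv /= => /andP[lt1 lt2]; apply/andP; split.
    by apply: le_trans lt1; rewrite lef_pV2 ?posrE // ler_nat.
  by apply: le_trans lt2 _; rewrite ler_nat.
- exact: measurable_itv.
- exact: measurable_Gamma_integrand.
- exact: Gamma_integrand_ge0.
Qed.

Lemma Gamma_integralS s : 0 < s ->
  Gamma_integral (s + 1) = (s%:E * Gamma_integral s)%E.
Proof.
move=> s0.
have lhs := @cvg_Gamma_integral (s + 1).
have rhs : ((k.+2%:R^-1 `^ s * expR (- k.+2%:R^-1)
      - k.+2%:R `^ s * expR (- k.+2%:R))%R%:E +
    s%:E * \int[mu]_(t in segment k) integrand s t)%E @[k --> \oo]
    --> (0%:E + s%:E * Gamma_integral s)%E.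
  apply: cvgeD => //.
  - by apply: cvg_EFin; [exact: nearW|exact: cvg_Gamma_boundary].
  - exact: (cvgeZl _ (cvg_Gamma_integral s)).
rewrite -[RHS]add0e; apply: (cvg_unique (@ereal_hausdorff R) lhs).
apply: cvg_trans rhs; apply: near_eq_cvg; apply: nearW => k.
have ends : 0 < (k.+2%:R^-1 : R) < k.+2%:R.
  rewrite invr_gt0 ltr0n /=.
  by rewrite (@le_lt_trans _ _ 1) ?ltr1n // invf_le1 ?ler1n.
exact: esym (@Gamma_integrand_by_parts s _ _ s0 ends).
Qed.

Lemma Gamma_integral_nat_fin (m : nat) : (Gamma_integral m.+1%:R < +oo)%E.
Proof.
elim: m => [|m IH].
  have le1 : (Gamma_integral 1 <= 1)%E.
    rewrite -(integral_exponential_pdf (@ltr01 R)).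
    have -> : Gamma_integral 1 =
        (\int[mu]_(t in `]0%R, +oo[) (exponential_pdf 1 t)%:E)%E.
      apply: eq_integral => t; rewrite inE /= in_itv /= andbT => t0.
      by rewrite exponential_pdfE ?ltW // subrr powRr0 mulN1r.
    apply: ge0_subset_integral => //.
      by apply/measurable_EFinP; exact: measurable_exponential_pdf.
    by move=> t _; rewrite lee_fin exponential_pdf_ge0.
  by apply: le_lt_trans le1 _; exact: ltry.
rewrite -natr1 Gamma_integralS ?ltr0n //.
by rewrite lte_mul_pinfty // lee_fin.
Qed.

(** At $s + 1$ the exponent is positive and $t^s \le 1 + t^m$ for an integer $m \ge s$, which
    reduces to integer arguments. The functional equation carries finiteness down to [s]. *)
Lemma Gamma_integral_fin s : 0 < s -> (Gamma_integral s < +oo)%E.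
Proof.
move=> s0.
have [m sm] : exists m : nat, s <= m%:R.
  by exists (Num.truncn s).+1; rewrite ltW // truncnS_gt.
have fin : (Gamma_integral (s + 1) < +oo)%E.
  apply: (@le_lt_trans _ _ (Gamma_integral 1 + Gamma_integral m.+1%:R)%E).
    rewrite /Gamma_integral -ge0_integralD //; first last.
    + exact: measurable_Gamma_integrand.
    + by move=> t _; exact: Gamma_integrand_ge0.
    + exact: measurable_Gamma_integrand.
    + by move=> t _; exact: Gamma_integrand_ge0.
    apply: ge0_le_integral => //.
    + by move=> t _; exact: Gamma_integrand_ge0.
    + exact: measurable_Gamma_integrand.
    + by apply: emeasurable_funD; exact: measurable_Gamma_integrand.
    move=> t /=; rewrite in_itv /= andbT => t0.
    rewrite -EFinD lee_fin -mulrDl ler_wpM2r ?expR_ge0 //.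
    rewrite -natr1 !addrK subrr powRr0.
    have [t1|t1] := leP t 1.
      rewrite ler_wpDr ?powR_ge0 //.
      by rewrite -[leRHS](powRr0 t) ger_powR ?t0 // ltW.
    by rewrite ler_wpDl // ler_powR // ltW.
  by rewrite lte_add_pinfty // (Gamma_integral_nat_fin 0, Gamma_integral_nat_fin).
rewrite ltNge leye_eq; apply/eqP => sy.
by move: fin; rewrite Gamma_integralS // sy gt0_muley ?ltxx // lte_fin.
Qed.

(** At $s + 1$ the integrand is at least $e^{-2}$ on $[1, 2]$; the functional equation transfers
    positivity to [s]. *)
Lemma Gamma_integral_gt0 s : 0 < s -> (0 < Gamma_integral s)%E.
Proof.
move=> s0.
have : (0 < Gamma_integral (s + 1))%E.
  apply: (@lt_le_trans _ _ (\int[mu]_(t in `[1%R, 2%R]) (expR (- 2))%:E)%E).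
    rewrite integral_cst //= lebesgue_measure_itv /= lte_fin ltr1n.
    by rewrite -EFinB -EFinM lte_fin mulr_gt0 ?expR_gt0 //; lra.
  apply: (@le_trans _ _ (\int[mu]_(t in `[1%R, 2%R]) integrand (s + 1) t)%E).
    apply: ge0_le_integral => //.
      exact: measurable_Gamma_integrand.
    move=> t /=; rewrite in_itv /= => /andP[t1 t2].
    rewrite lee_fin addrK -[leLHS]mul1r ler_pM ?expR_ge0 //.
      by rewrite -(powRr0 t) ler_powR // ltW.
    by rewrite ler_expR lerN2.
  apply: ge0_subset_integral => //.
  + exact: measurable_Gamma_integrand.
  + by move=> t _; exact: Gamma_integrand_ge0.
  + move=> t /=; rewrite !in_itv /= andbT => /andP[t1 _].
    exact: lt_le_trans t1.
rewrite Gamma_integralS // => h.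
rewrite lt_neqAle Gamma_integral_ge0 andbT eq_sym; apply/eqP => G0.
by move: h; rewrite G0 mule0 ltxx.
Qed.

Lemma Gamma_gt0 s : 0 < s -> 0 < Gamma s.
Proof.
move=> s0; rewrite /Gamma /Rintegral fine_gt0 //.
by rewrite Gamma_integral_gt0 //= Gamma_integral_fin.
Qed.

Lemma GammaS s : 0 < s -> Gamma (s + 1) = s * Gamma s.
Proof.
move=> s0; rewrite /Gamma /Rintegral.
rewrite -[X in fine X]/(Gamma_integral (s + 1)) Gamma_integralS //.
rewrite fineM // ge0_fin_numE ?Gamma_integral_ge0 //.
exact: Gamma_integral_fin.
Qed.

Lemma Gamma_addn s (k : nat) : 0 < s ->
  Gamma (s + k%:R) = Gamma s * \prod_(j < k) (s + j%:R).
Proof.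
move=> s0; elim: k => [|k IH]; first by rewrite big_ord0 addr0 mulr1.
rewrite -natr1 addrA GammaS ?ltr_wpDr // IH big_ord_recr /=.
by rewrite mulrC mulrA.
Qed.

End GammaIntegral.

(** * Bounds on the terms *)

Section RisingFactorial.
Context {R : realFieldType}.
Implicit Types x : R.

Lemma ler_rising x x' (k : nat) : 0 <= x <= x' ->
  \prod_(j < k) (x + j%:R) <= \prod_(j < k) (x' + j%:R).
Proof.
move=> /andP[x0 xx']; apply: ler_prod => j _.
by rewrite addr_ge0 //= lerD2r.
Qed.

Lemma rising1 (k : nat) : \prod_(j < k) (1 + j%:R) = k`!%:R :> R.
Proof.
elim: k => [|k IH]; first by rewrite big_ord0.
by rewrite big_ord_recr /= IH nat1r factS natrM mulrC.
Qed.

Lemma rising_ge_half_fact x (k : nat) : 2^-1 <= x ->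
  2^-1 * k`!%:R <= \prod_(j < k.+1) (x + j%:R).
Proof.
move=> x_half.
rewrite big_ord_recl addr0 -rising1; apply: ler_pM => //.
  by rewrite prodr_ge0 // => j _; rewrite addr_ge0.
apply: ler_prod => j _; rewrite addr_ge0 //=.
by rewrite /bump /= add1n -natr1; lra.
Qed.

Lemma rising_ge_fact x (k : nat) : 1 <= x ->
  k`!%:R <= \prod_(j < k.+1) (x + j%:R).
Proof.
move=> x1; apply: (@le_trans _ _ (\prod_(j < k.+1) (1 + j%:R))).
  by rewrite rising1 ler_nat factS leq_pmull.
by apply: ler_rising; rewrite ler01.
Qed.

Lemma rising_half_ge_fact (k : nat) : (3 <= k)%N ->
  k`!%:R <= \prod_(j < k.+1) (2^-1 + j%:R) :> R.
Proof.
elim: k => // k IH; rewrite leq_eqVlt => /predU1P[[<-]|/IH {}IH].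
  (* Base case $k = 3$: the product is $105/16$, just above $3! = 6$. *)
  by rewrite !big_ord_recr big_ord0 /= !factS fact0 !natrM; lra.
rewrite big_ord_recr /= factS natrM mulrC ler_pM //.
by rewrite lerDr invr_ge0.
Qed.

End RisingFactorial.

(** * Elementary exponential inequalities and the two exceptional coefficients *)

Section ExpBounds.
Context {R : realType}.
Implicit Types x r s : R.

(** The tangent at $1$ gives $e^x \ge e x$, and $12/5$ is a rational lower bound of $e$ since $e \ge
    (1 + 1/4)^4 = 625/256$. *)
Lemma expR_ge_linear x : 12 / 5 * x <= expR x.
Proof.
have e_ge : 12 / 5 <= expR 1 :> R.
  have q : 5 / 4 <= expR 4^-1 :> R by have := expR_ge1Dx (4^-1 : R); lra.
  have -> : expR 1 = expR 4^-1 ^+ 4 :> R.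
    by rewrite -expRM_natl divff // pnatr_eq0.
  have : (5 / 4) ^+ 4 <= expR 4^-1 ^+ 4 :> R by rewrite lerXn2r // nnegrE; lra.
  by lra.
have [x0|x0] := leP x 0.
  by apply: le_trans (expR_ge0 x); lra.
have -> : expR x = expR 1 * expR (x - 1) by rewrite -expRD addrC subrK.
apply: ler_pM => //; first exact: ltW.
by have := expR_ge1Dx (x - 1); lra.
Qed.

Lemma expR_ge_square x : 0 <= x -> 36 / 25 * x ^+ 2 <= expR x.
Proof.
move=> x0; have -> : expR x = expR (x / 2) ^+ 2.
  by rewrite expr2 -expRD; congr expR; field.
have -> : 36 / 25 * x ^+ 2 = (12 / 5 * (x / 2)) ^+ 2 by field.
by rewrite lerXn2r ?nnegrE ?expR_ge0 ?expR_ge_linear //; lra.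
Qed.

(** Squaring reduces this to $(1 + r/2)^2 (1 - r) = 1 - 3r^2/4 - r^3/4 \le 1$. *)
Lemma powR_Nhalf_ge r : 0 <= r < 1 -> 1 + r / 2 <= (1 - r) `^ (- 2^-1).
Proof.
move=> /andP[r0 r1].
set q := _ `^ _; have q0 : 0 <= q by exact: powR_ge0.
have q2 : q ^+ 2 * (1 - r) = 1.
  have r1' : 0 < 1 - r by lra.
  rewrite expr2 /q -powRD; last by rewrite (gt_eqF r1') implybT.
  have -> : - 2^-1 + - 2^-1 = -1 :> R by lra.
  by rewrite powR_inv1 ?ltW // mulVf ?gt_eqF.
rewrite leNgt; apply/negP => qlt.
have : q ^+ 2 * (1 - r) < (1 + r / 2) ^+ 2 * (1 - r).
  by rewrite ltr_pM2r ?subr_gt0 // ltrXn2r.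
by rewrite q2; nra.
Qed.

Context (r s : R) (r01 : 0 <= r < 1) (s0 : 0 <= s).
(** This is the bound of [exp_recursion_bound] for a single index. Its exponent [x] replaces [s]
    below through $s r = 2 x (1 + r)$. *)
Let M := (1 - r) `^ (- 2^-1) * expR (2^-1 * (s * r / (1 + r))).
Let x := 2^-1 * (s * r / (1 + r)).

Let x_ge0 : 0 <= x.
Proof.
have /andP[r0 _] := r01.
by rewrite /x mulr_ge0 ?invr_ge0 // divr_ge0 ?mulr_ge0 // addr_ge0.
Qed.

Let xE : s * r = 2 * x * (1 + r).
Proof. by have /andP[r0 _] := r01; rewrite /x; field; lra. Qed.

Let M_ge : (1 + r / 2) * expR x <= M.
Proof. by rewrite ler_wpM2r ?expR_ge0 ?powR_Nhalf_ge. Qed.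

Let M_ge1 : 1 <= M.
Proof.
apply: le_trans M_ge; have /andP[r0 _] := r01.
have e1 := expR_ge1Dx x; have := x_ge0.
have : 0 <= r / 2 * expR x by rewrite mulr_ge0 ?expR_ge0 //; lra.
lra.
Qed.

Lemma order1_coef_le : `|2^-1 * (1 - s) * r| <= 3 / 4 * M.
Proof.
have /andP[r0 r1] := r01; have M1 := M_ge1.
have sr0 : 0 <= s * r by rewrite mulr_ge0.
have key : 2^-1 * (s * r) <= 3 / 4 * M.
  have h1 : x <= 5 / 12 * expR x by have := expR_ge_linear x; lra.
  (* $1 + r \le \frac43 (1 + r/2)$ with equality at $r = 1$; the resulting constant is $\frac{5}{12}
     \cdot \frac43 = \frac59 < \frac34$. *)
  have h2 : x * (1 + r) <= (5 / 12 * expR x) * (4 / 3 * (1 + r / 2)).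
    by apply: ler_pM => //; lra.
  by rewrite xE; move: M_ge; lra.
by rewrite ler_norml; apply/andP; split; lra.
Qed.

Lemma order2_coef_le : `|8^-1 * (s ^+ 2 - 6 * s + 3) * r ^+ 2| <= 15 / 16 * M.
Proof.
have /andP[r0 r1] := r01; have M1 := M_ge1.
have r2 : 0 <= r ^+ 2 <= 1 by rewrite sqr_ge0 expr_le1 // ltW.
(* For $s \le 3$ the polynomial $(s - 3)^2 - 6$ is at most 6 in modulus, and $6/8 < 15/16$. For $s >
   3$ its modulus is at most $s^2$. *)
have [s3|s3] := leP s 3.
  have : `|s ^+ 2 - 6 * s + 3| <= 6.
    have h1 := sqr_ge0 (s - 3); have h2 : 0 <= s * (3 - s) by rewrite mulr_ge0 ?subr_ge0.
    by rewrite ler_norml; apply/andP; split; move: h1 h2 s0 s3; lra.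
  rewrite normrM normrM (ger0_norm (proj1 (andP r2))).
  rewrite ger0_norm // => h.
  have : 8^-1 * `|s ^+ 2 - 6 * s + 3| * r ^+ 2 <= 8^-1 * 6 * 1.
    apply: ler_pM; rewrite ?mulr_ge0 //; by [lra | case/andP: r2].
  lra.
have key : 8^-1 * s ^+ 2 * r ^+ 2 <= 15 / 16 * M.
  have h1 : x ^+ 2 <= 25 / 36 * expR x by have := expR_ge_square x x_ge0; lra.
  (* $(1 + r)^2 \le \frac83 (1 + r/2)$ with equality at $r = 1$; halving the product of constants
     gives $25/27 < 15/16$. *)
  have h2 : x ^+ 2 * (1 + r) ^+ 2 <= (25 / 36 * expR x) * (8 / 3 * (1 + r / 2)).
    by apply: ler_pM => //; [exact: sqr_ge0|exact: sqr_ge0|nra].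
  have -> : 8^-1 * s ^+ 2 * r ^+ 2 = 2^-1 * (x ^+ 2 * (1 + r) ^+ 2).
    by rewrite -mulrA -exprMn xE; field.
  have : 0 <= expR x * (1 + r / 2) by rewrite mulr_ge0 ?expR_ge0 //; lra.
  by move: M_ge; lra.
apply: le_trans key; rewrite normrM normrM (ger0_norm (proj1 (andP r2))).
rewrite ger0_norm // ler_wpM2r ?(proj1 (andP r2)) // ler_wpM2l //.
have h : 0 <= s * (s - 3) by rewrite mulr_ge0 // subr_ge0 ltW.
by rewrite ler_norml; apply/andP; split; lra.
Qed.

End ExpBounds.

(* For n = 1 and k = 1, 2 the factor on the right is 3/4 and 15/16, so that the
   bound of [exp_recursion_bound] has to be sharpened; otherwise it is at least 1. *)
Lemma exp_recursion_rising_bound {R : realType} {n : nat} (r s : 'I_n -> R)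
    (a : nat -> R) (k : nat) :
  (0 < n)%N -> (forall i, 0 <= r i < 1) -> (forall i, 0 <= s i) -> a 0%N = 1 ->
  exp_recursion (fun k => 2^-1 * \sum_i (1 - k%:R * s i) * r i ^+ k) a ->
  (0 < k)%N ->
  `|a k| <= (\prod_(j < k.+1) (n%:R / 2 + j%:R)) / k`!%:R *
    (\prod_i (1 - r i) `^ (- 2^-1) * expR (2^-1 * \sum_i s i * r i / (1 + r i))).
Proof.
move=> n0 r01 s_ge0 a0 arec k0.
have M_ge0 : 0 <= \prod_i (1 - r i) `^ (- 2^-1) *
    expR (2^-1 * \sum_i s i * r i / (1 + r i)).
  by rewrite mulr_ge0 ?expR_ge0 // prodr_ge0 // => i _; exact: powR_ge0.
have generic : k`!%:R <= \prod_(j < k.+1) (n%:R / 2 + j%:R) :> R ->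
    `|a k| <= (\prod_(j < k.+1) (n%:R / 2 + j%:R)) / k`!%:R *
    (\prod_i (1 - r i) `^ (- 2^-1) * expR (2^-1 * \sum_i s i * r i / (1 + r i))).
  move=> hk; apply: le_trans (exp_recursion_bound r s a r01 s_ge0 a0 arec k) _.
  by rewrite ler_peMl // ler_pdivlMr ?mul1r // ltr0n fact_gt0.
case: n n0 r s r01 s_ge0 arec M_ge0 generic => [//|[|n]] _ r s r01 s_ge0 arec _ generic;
  last first.
  apply: generic; apply: rising_ge_fact.
  by rewrite ler_pdivlMr // mul1r ler_nat.
have [k3|k3] := ltnP 2 k.
  by apply: generic; rewrite div1r rising_half_ge_fact.
rewrite !big_ord1 in generic *.
(* Only $n = 1$ with $k \in \{1, 2\}$ remains, where the recursion is solved explicitly. *)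
have rec1 := arec 1%N; have rec2 := arec 2%N.
rewrite !big_ord_recr !big_ord0 /= a0 in rec1 rec2.
have max0 : ord_max = ord0 :> 'I_1 by exact: val_inj.
rewrite max0 ?subn0 ?subn1 /= ?expr1 in rec1 rec2.
have a1E : a 1%N = 2^-1 * (1 - s ord0) * r ord0 by lra.
have a2E : a 2%N = 8^-1 * (s ord0 ^+ 2 - 6 * s ord0 + 3) * r ord0 ^+ 2.
  by rewrite a1E in rec2; lra.
case: k k0 k3 {generic} => [//|[|[|//]]] _ _.
  rewrite a1E !big_ord_recr big_ord0 /=.
  have -> : 1 * (1 / 2 + 0) * (1 / 2 + 1) / 1`!%:R = 3 / 4 :> R.
    by rewrite (_ : 1`! = 1%N) //; field.
  exact: order1_coef_le.
rewrite a2E !big_ord_recr big_ord0 /=.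
have -> : 1 * (1 / 2 + 0) * (1 / 2 + 1) * (1 / 2 + 2) / 2`!%:R = 15 / 16 :> R.
  by rewrite (_ : 2`! = 2%N) //; field.
exact: order2_coef_le.
Qed.

(** * Cauchy-type bounds for the coefficients [c_coef] *)

Section CoefficientBounds.
Context {R : realType} {n : nat} (lam : 'rV[R]_n) (b : 'cV[R]_n) (rho : R).
Hypotheses (rho_gt0 : 0 < rho) (rho_lt : forall j, rho < lam 0 j).

Let r (i : 'I_n) := rho / lam 0 i.
Let s (i : 'I_n) := b i 0 ^+ 2.
(** Substituting $z = 2 \rho w$ and dividing by $c_0$ turns $z / (2 \lambda_i)$ into $r_i w$ and
    normalizes the first coefficient to 1. *)
Let a k := c_coef lam b k * (2 * rho) ^+ k / c0_coef lam b.
Let M := \prod_i (1 - r i) `^ (- 2^-1) * expR (2^-1 * \sum_i s i * r i / (1 + r i)).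

Let lam_gt0 j : 0 < lam 0 j.
Proof. exact: lt_trans (rho_lt j). Qed.

Let r01 i : 0 <= r i < 1.
Proof.
by rewrite /r divr_ge0 ?(ltW rho_gt0) ?(ltW (lam_gt0 i)) //= ltr_pdivrMr ?mul1r.
Qed.

Let s_ge0 i : 0 <= s i.
Proof. exact: sqr_ge0. Qed.

Lemma c0_coef_gt0 : 0 < c0_coef lam b.
Proof.
rewrite mulr_gt0 ?expR_gt0 // prodr_gt0 // => i _.
by rewrite powR_gt0 // mulr_gt0.
Qed.

Let a0 : a 0%N = 1.
Proof. by rewrite /a c_coef0 expr0 mulr1 divff ?gt_eqF ?c0_coef_gt0. Qed.

Let aE k : c_coef lam b k = c0_coef lam b * a k / (2 * rho) ^+ k.
Proof.
have := c0_coef_gt0; rewrite /a => c0.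
have rk : 0 < (2 * rho) ^+ k by rewrite exprn_gt0 // mulr_gt0.
by field; rewrite !gt_eqF.
Qed.

Let arec : exp_recursion (fun k => 2^-1 * \sum_i (1 - k%:R * s i) * r i ^+ k) a.
Proof.
case=> [|k]; first by rewrite mul0r big_ord0.
rewrite /a c_coef_rec // !mulrA mulfV ?mul1r ?pnatr_eq0 // !mulr_suml.
apply: eq_bigr => j _.
have jk : (j <= k.+1)%N by exact: ltnW.
have -> : (2 * rho) ^+ k.+1 = (2 * rho) ^+ (k.+1 - j) * (2 * rho) ^+ j.
  by rewrite -exprD subnK.
have -> : 2^-1 * (\sum_i (1 - (k.+1 - j)%:R * s i) * r i ^+ (k.+1 - j)) =
    d_coef lam b (k.+1 - j) * (2 * rho) ^+ (k.+1 - j).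
  rewrite /d_coef -mulrA mulr_suml; congr (_ * _); apply: eq_bigr => i _.
  rewrite -mulrA; congr (_ * _).
  rewrite -exprVn -exprMn /r; congr (_ ^+ _).
  by have := lam_gt0 i; move=> l0; field; rewrite gt_eqF.
by ring.
Qed.

(** Since $r_i/(1 + r_i) = \rho/(\lambda_i + \rho)$, the exponents combine by $-1 + \rho/(\lambda_i
    + \rho) = -\lambda_i/(\lambda_i + \rho)$; the factors 2 in $c_0$ give $2^{-n/2}$. *)
Let c0M : c0_coef lam b * M = 2 `^ (- (n%:R / 2)) * m_bound lam b rho.
Proof.
have -> : 2 `^ (- (n%:R / 2)) = \prod_(i < n) 2 `^ (- 2^-1) :> R.
  rewrite prodr_const card_ord -powR_mulrn ?powR_ge0 // -powRrM.
  by congr (_ `^ _); field.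
rewrite /c0_coef /m_bound /M.
have -> : \prod_i (2 * lam 0 i) `^ (- 2^-1) =
    \prod_(i < n) 2 `^ (- 2^-1) * \prod_i lam 0 i `^ (- 2^-1).
  by rewrite -big_split; apply: eq_bigr => i _; rewrite powRM ?ltW.
have -> : expR (- (2^-1 * \sum_j b j 0 ^+ 2 * lam 0 j / (lam 0 j + rho))) =
    expR (- (2^-1 * \sum_i b i 0 ^+ 2)) *
    expR (2^-1 * \sum_i s i * r i / (1 + r i)).
  rewrite -expRD -mulrN -mulrN -mulrDr -!sumrN -big_split /=.
  congr (expR (_ * _)); apply: eq_bigr => i _.
  have l0 := lam_gt0 i; rewrite /s /r; field.
  by rewrite !gt_eqF ?addr_gt0.
by rewrite /r; ring.
Qed.

Lemma m_bound_ge0 : 0 <= m_bound lam b rho.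
Proof.
by rewrite !mulr_ge0 ?expR_ge0 // prodr_ge0 // => i _; exact: powR_ge0.
Qed.

Lemma c_coef_le k :
  `|c_coef lam b k| <= 2 `^ (- (n%:R / 2)) * m_bound lam b rho / (2 * rho) ^+ k.
Proof.
have rk : 0 < (2 * rho) ^+ k by rewrite exprn_gt0 // mulr_gt0.
rewrite aE -c0M normrM normfV (gtr0_norm rk) normrM (gtr0_norm c0_coef_gt0).
rewrite ler_pM2r ?invr_gt0 // ler_pM2l ?c0_coef_gt0 //.
exact: (exp_recursion_bound r s a r01 s_ge0 a0 arec).
Qed.

Lemma c_coef_rising_le k : (0 < n)%N -> (0 < k)%N ->
  `|c_coef lam b k| <= (\prod_(j < k.+1) (n%:R / 2 + j%:R)) / k`!%:R *
    (2 `^ (- (n%:R / 2)) * m_bound lam b rho / (2 * rho) ^+ k).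
Proof.
move=> n0 k0.
have rk : 0 < (2 * rho) ^+ k by rewrite exprn_gt0 // mulr_gt0.
rewrite aE -c0M normrM normfV (gtr0_norm rk) normrM (gtr0_norm c0_coef_gt0).
rewrite mulrA ler_pM2r ?invr_gt0 // mulrCA ler_pM2l ?c0_coef_gt0 //.
exact: (exp_recursion_rising_bound r s a).
Qed.

End CoefficientBounds.

(** * Comparison of tails with the exponential series *)

Lemma exp_partial_sum_le {R : realType} (x : R) (m : nat) : 0 <= x ->
  \sum_(0 <= i < m) x ^+ i / i`!%:R <= expR x.
Proof.
move=> x0; apply: (nondecreasing_cvgn_le _ (@is_cvg_series_exp_coeff _ x)).
apply/nondecreasing_seqP => k; rewrite /series /= big_nat_recr //= lerDl.
by rewrite divr_ge0 ?exprn_ge0.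
Qed.

Lemma nneseries_exp_le {R : realType} (u : nat -> R) (N : nat) (C x : R) :
  0 <= C -> 0 <= x -> (forall i, `|u (N + i)%N| <= C * (x ^+ i / i`!%:R)) ->
  (\sum_(N <= k <oo) `|u k|%:E <= (C * expR x)%:E)%E.
Proof.
move=> C0 x0 uC; apply: lime_le.
  by apply: is_cvg_nneseries => k _ _; rewrite lee_fin.
apply: nearW => m; rewrite sumEFin lee_fin -{1}(add0n N) big_addn.
apply: le_trans (ler_wpM2l C0 (exp_partial_sum_le x (m - N) x0)).
by rewrite mulr_sumr; apply: ler_sum => i _; rewrite addnC.
Qed.

(** The quotient is a binomial coefficient, hence at least 1. *)
Lemma leq_fact_mul (m i : nat) : (m`! * i`! <= (m + i)`!)%N.
Proof.
rewrite -(bin_fact (leq_addr i m)) addKn.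
by rewrite leq_pmull // bin_gt0 leq_addr.
Qed.

(** The first tail term splits off as a factor. The indices [p] and [m] are independent because for
    the density the power is one ahead of the factorial. *)
Lemma ler_exp_term_shift {R : realType} (x : R) (p m i : nat) : 0 <= x ->
  x ^+ (p + i) / (m + i)`!%:R <= x ^+ p / m`!%:R * (x ^+ i / i`!%:R).
Proof.
move=> x0; rewrite mulrACA -exprD -invfM -natrM ler_wpM2l ?exprn_ge0 //.
by rewrite lef_pV2 ?posrE ?ltr0n ?muln_gt0 ?fact_gt0 // ler_nat leq_fact_mul.
Qed.

Lemma lt_min_entry {R : realType} {n : nat} (lam : 'rV[R]_n) (rho : R) :
  (rho%:E < min_entry lam)%E -> forall j, rho < lam 0 j.
Proof.
move=> h j; rewrite -lte_fin; apply: lt_le_trans h _.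
by rewrite /min_entry (bigminD1 j) //= ge_min lexx.
Qed.

Section TermBounds.
Context {R : realType} {n : nat} (lam : 'rV[R]_n) (b : 'cV[R]_n) (rho y : R).
Hypotheses (n_gt0 : (0 < n)%N) (rho_gt0 : 0 < rho) (y_gt0 : 0 < y).
Hypothesis rho_lt : forall j, rho < lam 0 j.

Let n2_gt0 : 0 < n%:R / 2 :> R.
Proof. by rewrite divr_gt0 ?ltr0n. Qed.

Let powR_half (x : R) : (y / 2) `^ x = y `^ x * 2 `^ (- x).
Proof. by rewrite powRM ?ltW // powRN -powR_inv1 // -powRrM mulN1r -powRN. Qed.

Lemma pdf_term_le k :
  `|pdf_term lam b y k.+1| <= m_bound lam b rho / Gamma (n%:R / 2) *
    (y / 2) `^ (n%:R / 2 - 1) * ((y / (2 * rho)) ^+ k.+1 / k`!%:R).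
Proof.
have G0 := Gamma_gt0 _ n2_gt0.
have rk : 0 < (2 * rho) ^+ k.+1 by rewrite exprn_gt0 // mulr_gt0.
have k0 : 0 < k`!%:R :> R by rewrite ltr0n fact_gt0.
have m0 : 0 <= m_bound lam b rho by exact: m_bound_ge0.
rewrite /pdf_term Gamma_addn // normrM normrM normfV.
rewrite (ger0_norm (powR_ge0 _ _)).
have rising_ge : 2^-1 * k`!%:R <= \prod_(j < k.+1) (n%:R / 2 + j%:R) :> R.
  apply: rising_ge_half_fact.
  by rewrite -[leLHS]mul1r ler_pM2r ?invr_gt0 // ler1n.
have rising_gt0 : 0 < \prod_(j < k.+1) (n%:R / 2 + j%:R) :> R.
  by apply: lt_le_trans rising_ge; rewrite mulr_gt0 ?invr_gt0.
rewrite [`|_ * \prod_(_ < _) _|]gtr0_norm ?mulr_gt0 //.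
have -> : y `^ (n%:R / 2 + k.+1%:R - 1) = y `^ (n%:R / 2 - 1) * y ^+ k.+1.
  rewrite -powR_mulrn ?ltW // -powRD; last by rewrite (gt_eqF y_gt0) implybT.
  by congr (_ `^ _); ring.
have c_le := c_coef_le lam b rho rho_gt0 rho_lt k.+1.
have w_le : y `^ (n%:R / 2 - 1) * y ^+ k.+1 /
      (Gamma (n%:R / 2) * \prod_(j < k.+1) (n%:R / 2 + j%:R)) <=
    y `^ (n%:R / 2 - 1) * y ^+ k.+1 / (Gamma (n%:R / 2) * (2^-1 * k`!%:R)).
  rewrite ler_wpM2l ?mulr_ge0 ?powR_ge0 ?exprn_ge0 ?(ltW y_gt0) //.
  by rewrite lef_pV2 ?posrE ?mulr_gt0 ?invr_gt0 // ler_pM2l.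
have w_ge0 : 0 <= y `^ (n%:R / 2 - 1) * y ^+ k.+1 /
    (Gamma (n%:R / 2) * \prod_(j < k.+1) (n%:R / 2 + j%:R)).
  by rewrite divr_ge0 ?mulr_ge0 ?powR_ge0 ?exprn_ge0 // ltW.
apply: le_trans (ler_pM (normr_ge0 _) w_ge0 c_le w_le) _.
(* The factor 2 lost in bounding the rising product by $k!/2$ is exactly the ratio of $2^{-(n/2-1)}$
   to $2^{-n/2}$, so what remains is an equality. *)
have two : 2 `^ (- (n%:R / 2 - 1)) = 2 * 2 `^ (- (n%:R / 2)) :> R.
  by rewrite opprB powRD ?pnatr_eq0 ?implybT // powRr1.
rewrite powR_half two [(y / _) ^+ _]expr_div_n le_eqVlt; apply/orP; left; apply/eqP.
by field; rewrite !gt_eqF.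
Qed.

Lemma cdf_term_le k : (0 < k)%N ->
  `|cdf_term lam b y k| <= m_bound lam b rho / Gamma (n%:R / 2) *
    (y / 2) `^ (n%:R / 2) * ((y / (2 * rho)) ^+ k / k`!%:R).
Proof.
move=> k_gt0; have G0 := Gamma_gt0 _ n2_gt0.
have rk : 0 < (2 * rho) ^+ k by rewrite exprn_gt0 // mulr_gt0.
have k0 : 0 < k`!%:R :> R by rewrite ltr0n fact_gt0.
rewrite /cdf_term -addrA natr1 Gamma_addn // normrM normrM normfV.
rewrite (ger0_norm (powR_ge0 _ _)).
have rising_gt0 : 0 < \prod_(j < k.+1) (n%:R / 2 + j%:R) :> R.
  by rewrite prodr_gt0 // => j _; rewrite ltr_wpDr.
rewrite [`|_ * \prod_(_ < _) _|]gtr0_norm ?mulr_gt0 //.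
have -> : y `^ (n%:R / 2 + k%:R) = y `^ (n%:R / 2) * y ^+ k.
  rewrite -powR_mulrn ?ltW // -powRD //; by rewrite (gt_eqF y_gt0) implybT.
(* The rising product in this bound is the one produced by $\Gamma(n/2 + k + 1)$; it cancels exactly
   and leaves $1/k!$. *)
have c_le := c_coef_rising_le lam b rho rho_gt0 rho_lt k n_gt0 k_gt0.
apply: le_trans (ler_wpM2r _ c_le) _.
  by rewrite divr_ge0 ?mulr_ge0 ?powR_ge0 ?exprn_ge0 // ltW.
rewrite powR_half [(y / _) ^+ _]expr_div_n le_eqVlt; apply/orP; left; apply/eqP.
by field; rewrite !gt_eqF.
Qed.

Lemma truncation_factor_ge0 (u : R) :
  0 <= m_bound lam b rho / Gamma (n%:R / 2) * (y / 2) `^ u.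
Proof.
apply: mulr_ge0; last exact: powR_ge0.
by apply: divr_ge0; [exact: m_bound_ge0|rewrite ltW ?Gamma_gt0].
Qed.

End TermBounds.

Theorem mainTheorem4 (R : realType) (n : nat) (n_ge1 : (1 <= n)%N)
    (A Sigma : 'M[R]_n) (mu : 'cV[R]_n)
    (A_spd : sym_posdef A) (Sigma_spd : sym_posdef Sigma)
    (S : 'M[R]_n) (S_sqrt : is_sqrtmx Sigma S)
    (P : 'M[R]_n) (P_orth : orthogonalmx P)
    (lam : 'rV[R]_n) (lamE : P^T *m S *m A *m S *m P = diag_mx lam)
    (b : 'cV[R]_n) (bE : b = P^T *m invmx S *m mu)
    (N : nat) (y : R) (y_gt0 : 0 < y)
    (rho : R) (rho_gt0 : 0 < rho) (rho_lt : (rho%:E < min_entry lam)%E) :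
  (pdf_error lam b y N <=
     (m_bound lam b rho / (Gamma (n%:R / 2) * N`!%:R)
      * (y / 2) `^ (n%:R / 2 - 1) * (y / (2 * rho)) ^+ N.+1
      * expR (y / (2 * rho)))%:E)%E
  /\
  (cdf_error lam b y N <=
     (m_bound lam b rho / (Gamma (n%:R / 2) * (N.+1)`!%:R)
      * (y / 2) `^ (n%:R / 2) * (y / (2 * rho)) ^+ N.+1
      * expR (y / (2 * rho)))%:E)%E.
Proof.
have lam_gt := lt_min_entry lam rho rho_lt.
have t0 : 0 <= y / (2 * rho) by rewrite divr_ge0 ?mulr_ge0 ?ltW.
have F0 := truncation_factor_ge0 lam b rho y n_ge1.
split.
(* The bound is regrouped as a constant times the first tail term, with power $N + 1$ over $N!$, to
   match [ler_exp_term_shift]. *)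
- have -> : m_bound lam b rho / (Gamma (n%:R / 2) * N`!%:R)
      * (y / 2) `^ (n%:R / 2 - 1) * (y / (2 * rho)) ^+ N.+1 =
    m_bound lam b rho / Gamma (n%:R / 2) * (y / 2) `^ (n%:R / 2 - 1)
      * ((y / (2 * rho)) ^+ N.+1 / N`!%:R).
    by rewrite invfM; ring.
  apply: nneseries_exp_le => // [|i]; first by rewrite mulr_ge0 ?divr_ge0 ?exprn_ge0.
  rewrite addSn.
  apply: le_trans (pdf_term_le lam b rho y n_ge1 rho_gt0 y_gt0 lam_gt (N + i)) _.
  by rewrite -[leRHS]mulrA -addSn ler_wpM2l ?ler_exp_term_shift.
- have -> : m_bound lam b rho / (Gamma (n%:R / 2) * (N.+1)`!%:R)
      * (y / 2) `^ (n%:R / 2) * (y / (2 * rho)) ^+ N.+1 =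
    m_bound lam b rho / Gamma (n%:R / 2) * (y / 2) `^ (n%:R / 2)
      * ((y / (2 * rho)) ^+ N.+1 / (N.+1)`!%:R).
    by rewrite invfM; ring.
  apply: nneseries_exp_le => // [|i]; first by rewrite mulr_ge0 ?divr_ge0 ?exprn_ge0.
  apply: le_trans (cdf_term_le lam b rho y n_ge1 rho_gt0 y_gt0 lam_gt (N.+1 + i) _) _.
    by rewrite addSn.
  by rewrite -[leRHS]mulrA ler_wpM2l ?ler_exp_term_shift.
Qed.
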